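(* Let $k\ge 1$ be an integer and let $G=\mathrm{And}(k)$ be the Andrásfai graph. Then the adjacency matrix of $G$ has exactly $k+\lceil k/2\rceil$ distinct eigenvalues.
   Context: For an integer $k\ge 1$ put $n=3k-1$. The Andrásfai graph $\mathrm{And}(k)$ is the Cayley graph $\mathrm{Cay}(\mathbb{Z}_n,S)$ of the additive group $\mathbb{Z}_n=\{0,1,\dots,n-1\}$ with connection set $S=\{x\in\mathbb{Z}_n : x\equiv 1 \bmod 3\}=\{1,4,7,\dots,3k-2\}$, where the congruence mod $3$ is for the representatives $0,1,\dots,n-1$. That is, the vertices are the elements of $\mathbb{Z}_n$, and $u,v$ are adjacent iff $v-u\in S$ (the set $S$ satisfies $S=-S$ and $0\notin S$). *)

(* Defs.v *)
From HB Require Import structures.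
From mathcomp Require Import all_boot all_order all_algebra.
From mathcomp Require Import zify.

Set Implicit Arguments.
Unset Strict Implicit.
Unset Printing Implicit Defensive.

Import GRing.Theory.
Local Open Scope ring_scope.

Definition cayley (V : finZmodType) (S : {set V}) : rel V :=
  fun u v => v - u \in S.

(* ['Z_n] is the ring of integers modulo [n] only when [n >= 2], which holds
   for [n = 3k - 1] as soon as [k >= 1]. *)
Definition andrasfai_order (k : nat) : nat := (3 * k - 1)%N.

(* The congruence modulo 3 is on the representative [x < 3k - 1] in [nat]; it
   is not a condition on the residue class of [x] modulo [3k - 1]. *)
Definition andrasfai_set (k : nat) : {set 'Z_(andrasfai_order k)} :=
  [set x : 'Z_(andrasfai_order k) | ((x : nat) == 1 %[mod 3])%N].

Definition andrasfai (k : nat) : rel 'Z_(andrasfai_order k) :=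
  cayley (andrasfai_set k).

Definition adjacency_mx (R : pzSemiRingType) (m : nat) (e : rel 'I_m) :
  'M[R]_m := \matrix_(u, v) (e u v)%:R.

Definition has_n_distinct_eigenvalues (F : fieldType) (m : nat)
    (A : 'M[F]_m) (N : nat) : Prop :=
  exists s : seq F,
    [/\ uniq s, (forall a : F, (a \in s) = eigenvalue A a) & size s = N].

Lemma andrasfai_order_gt1 (k : nat) : (0 < k)%N -> (1 < andrasfai_order k)%N.
Proof. rewrite /andrasfai_order; lia. Qed.

Lemma andrasfai_irr (k : nat) : irreflexive (@andrasfai k).
Proof. by move=> u; rewrite /andrasfai /cayley subrr inE. Qed.

Lemma andrasfai_sym (k : nat) : (0 < k)%N -> symmetric (@andrasfai k).
Proof.
move=> k_gt0.
have def_n : ((Zp_trunc (andrasfai_order k)).+2 = 3 * k - 1)%N.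
  by rewrite Zp_cast ?andrasfai_order_gt1.
have sub (u v : 'Z_(andrasfai_order k)) : andrasfai u v -> andrasfai v u.
  rewrite /andrasfai /cayley -(opprB v u); move: (v - u) => x; rewrite !inE /=.
  have := ltn_ord x; move: (nat_of_ord x) => {u v} x.
  rewrite def_n => ltx /eqP x1.
  by apply/eqP; rewrite (modn_small (d := (3 * k - 1)%N)); lia.
by move=> u v; apply/idP/idP; apply: sub.
Qed.

(* Main.v *)
Require Import Defs.
From mathcomp Require Import all_boot all_order all_algebra.
From mathcomp Require Import cyclic separable cyclotomic zify ring.

(** The graph And(k) is a Cayley graph of the cyclic group of order
    n = 3k - 1, so the additive characters u |-> x ^ u, where x runs over the
    n-th roots of unity, diagonalise its adjacency matrix
    ([eigenvalue_cayley_ZnP]), with eigenvalues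
      lambda(x) = x + x^4 + ... + x^(3k-2)
    ([sum_andrasfai_set]).  Since x^(3k) = x, summing the geometric series
    gives, for x != 1,
      lambda(x) = x (x - 1) / (x^3 - 1) = 1 / (x + 1 + 1/x)
    ([andrasfai_eigMx]).  So, away from x = 1, lambda(x) determines x + 1/x,
    that is, it determines x up to inversion.  The remaining value is
    lambda(1) = k, and it is attained only at x = 1: a sum of k complex numbers
    of modulus 1 equals k only if all of them equal 1, and x is one of them.
    Hence lambda(x) = lambda(y) exactly when x = y or xy = 1
    ([andrasfai_eig_eqE]), and the distinct eigenvalues are lambda(w^j) with
    w a primitive n-th root of unity and 0 <= j <= n/2.  There are
    floor(n/2) + 1 = k + ceil(k/2) of them. *)

Set Implicit Arguments.
Unset Strict Implicit.
Unset Printing Implicit Defensive.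

Import GRing.Theory Num.Theory.
Local Open Scope ring_scope.

Lemma closed_prim_root_exists (F : closedFieldType) (n : nat) :
  n%:R != 0 :> F -> exists w : F, n.-primitive_root w.
Proof.
move=> n_neq0.
have n_gt0 : (0 < n)%N by case: n n_neq0 => //; rewrite eqxx.
have [rs] := closed_field_poly_normal ('X^n - 1 : {poly F}).
rewrite lead_coefXnsubC // scale1r => factored.
have roots_unity : all n.-unity_root rs.
  by apply/allP=> x; rewrite -root_prod_XsubC -factored.
have uniq_rs : uniq rs.
  by rewrite -separable_prod_XsubC -factored separable_Xn_sub_1.
have size_rs : (n <= size rs)%N.
  by rewrite -ltnS -(size_prod_XsubC rs id) -factored size_XnsubC.
by have /hasP[w _ prim_w] := has_prim_root n_gt0 roots_unity uniq_rs size_rs;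
  exists w.
Qed.

Section CayleyZn.

Variables (F : fieldType) (m : nat).
Implicit Types (S : {set 'I_m.+1}) (x : F).

Lemma expr_ordD x (u v : 'I_m.+1) :
  x ^+ m.+1 = 1 -> x ^+ (u + v)%R = x ^+ u * x ^+ v.
Proof. by move=> xn1; rewrite -exprD /= expr_mod. Qed.

Lemma adjacency_cayley_char S x (u : 'I_m.+1) : x ^+ m.+1 = 1 ->
  \sum_v adjacency_mx F (cayley S) u v * x ^+ v
    = (\sum_(s in S) x ^+ s) * x ^+ u.
Proof.
move=> xn1; rewrite (reindex (fun s : 'I_m.+1 => s + u)) /=; last first.
  by exists (fun v : 'I_m.+1 => v - u) => v _; rewrite ?addrK ?subrK.
rewrite mulr_suml [RHS]big_mkcond /=; apply: eq_bigr => s _.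
rewrite mxE /cayley addrK expr_ordD //.
by case: (s \in S); rewrite ?mul1r ?mul0r.
Qed.

(** The transposed adjacency matrix is that of the connection set - S, hence
    the inverse character: with it, row and column eigenvectors have the same
    eigenvalue for every S. *)
Lemma cayley_char_adjacency S x (v : 'I_m.+1) : x ^+ m.+1 = 1 ->
  \sum_(u < m.+1) x ^- u * adjacency_mx F (cayley S) u v
    = (\sum_(s in S) x ^+ s) * x ^- v.
Proof.
move=> xn1; rewrite (reindex (fun s : 'I_m.+1 => v - s)) /=; last first.
  by exists (fun u : 'I_m.+1 => v - u) => u _; rewrite subKr.
have x_unit : x \is a GRing.unit.
  by rewrite -(unitrX_pos _ (ltn0Sn m)) xn1 unitr1.
rewrite mulr_suml [RHS]big_mkcond /=; apply: eq_bigr => s _.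
rewrite mxE /cayley subKr.
case: (s \in S); rewrite ?mulr1 ?mulr0 //.
have /(congr1 (fun u : 'I_m.+1 => x ^+ u)) : (v - s) + s = v by rewrite subrK.
rewrite /= -[X in X = _]/(x ^+ ((v - s) + s)%R) expr_ordD // => <-.
by rewrite invrM ?unitrX // mulrA divrr ?unitrX // mul1r.
Qed.

(** Each character is an eigenvector.  Conversely, a row eigenvector whose
    eigenvalue is none of the character sums is orthogonal to all characters;
    read as a polynomial of degree at most m, it has m + 1 roots. *)
Lemma eigenvalue_cayley_ZnP S (w a : F) : m.+1.-primitive_root w ->
  reflect (exists j : 'I_m.+1, a = \sum_(s in S) (w ^+ j) ^+ s)
          (eigenvalue (adjacency_mx F (cayley S)) a).
Proof.
move=> prim_w.
have char1 j : (w ^+ j) ^+ m.+1 = 1.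
  by rewrite exprAC (prim_expr_order prim_w) expr1n.
apply: (iffP eigenvalueP) => [[v vA v_neq0] | [j ->]]; last first.
  exists (\row_u (w ^+ j) ^- u); last first.
    apply/eqP => /rowP/(_ ord0)/eqP.
    by rewrite !mxE expr0 invr1 oner_eq0.
  apply/rowP => u; rewrite !mxE -cayley_char_adjacency //.
  by apply: eq_bigr => i _; rewrite mxE.
suff /existsP[j /eqP ->] : [exists j : 'I_m.+1,
    a == \sum_(s in S) (w ^+ j) ^+ s] by exists j.
apply: contraNT v_neq0; rewrite negb_exists => /forallP a_new.
pose p : {poly F} := \poly_(i < m.+1) v 0 (inord i).
have pE x : p.[x] = \sum_u v 0 u * x ^+ u.
  by rewrite horner_poly; apply: eq_bigr => u _; rewrite inord_val.
have p0 : p = 0.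
  apply: (@roots_geq_poly_eq0 _ p [seq w ^+ nat_of_ord j | j : 'I_m.+1]).
  - apply/allP => _ /mapP[j _ ->]; rewrite /root pE.
    set x := w ^+ j; set c := \sum_u _.
    suff /eqP : a * c = (\sum_(s in S) x ^+ s) * c.
      rewrite -subr_eq0 -mulrBl mulf_eq0 subr_eq0 => /orP[|//].
      by have := a_new j => /eqP a_neq /eqP /a_neq.
    rewrite /c !mulr_sumr.
    transitivity (\sum_u (v *m adjacency_mx F (cayley S)) 0 u * x ^+ u).
      by apply: eq_bigr => u _; rewrite vA mxE mulrA.
    transitivity (\sum_t v 0 t *
                    \sum_u adjacency_mx F (cayley S) t u * x ^+ u).
      under eq_bigr do rewrite mxE mulr_suml.
      rewrite exchange_big; apply: eq_bigr => t _; rewrite mulr_sumr.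
      by apply: eq_bigr => u _; rewrite mulrA.
    apply: eq_bigr => t _; rewrite adjacency_cayley_char ?char1 //.
    by rewrite mulrCA.
  - rewrite map_inj_uniq ?enum_uniq // => i j /eqP.
    rewrite (eq_prim_root_expr prim_w) !modn_small //.
    by move/eqP/val_inj.
  - by rewrite size_image card_ord size_poly.
apply/eqP/rowP => u; rewrite mxE.
have := coef_poly m.+1 (fun i => v 0 (inord i)) u.
by rewrite -/p p0 coef0 ltn_ord inord_val.
Qed.

End CayleyZn.

Definition andrasfai_eig (R : pzSemiRingType) (k : nat) (x : R) : R :=
  \sum_(i < k) x ^+ (3 * i + 1).

Lemma sum_andrasfai_set (R : pzSemiRingType) (k : nat) (x : R) : (0 < k)%N ->
  \sum_(s in andrasfai_set k) x ^+ s = andrasfai_eig k x.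
Proof.
move=> k_gt0; under eq_bigl do rewrite inE.
rewrite -(big_mkord (fun i => (i == 1 %[mod 3])%N) (fun i => x ^+ i)).
rewrite Zp_cast ?andrasfai_order_gt1 // /andrasfai_order /andrasfai_eig.
have sum3 l : \sum_(0 <= i < 3 * l | (i == 1 %[mod 3])%N) x ^+ i
              = \sum_(i < l) x ^+ (3 * i + 1).
  elim: l => [|l IHl]; first by rewrite big_nil big_ord0.
  rewrite big_ord_recr /= -IHl !(big_mkcond (fun i => (i == 1 %[mod 3])%N)) /=.
  rewrite (_ : (3 * l.+1)%N = (3 * l).+3); last by lia.
  have cond0 : (3 * l == 1 %[mod 3])%N = false by lia.
  have cond1 : ((3 * l).+1 == 1 %[mod 3])%N by lia.
  have cond2 : ((3 * l).+2 == 1 %[mod 3])%N = false by lia.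
  by rewrite !big_nat_recr //= cond0 cond1 cond2 !addr0 addn1.
(* The index 3k - 1 missing on the left is 2 modulo 3. *)
rewrite -sum3 [RHS]big_mkcond [LHS]big_mkcond /=.
rewrite -[in RHS](@subnK 1 (3 * k)%N) ?addn1; last by lia.
by rewrite big_nat_recr //= [X in _ + X]ifN ?addr0 //; lia.
Qed.

Lemma andrasfai_eig1 (R : pzSemiRingType) (k : nat) :
  andrasfai_eig k 1 = k%:R :> R.
Proof.
by rewrite /andrasfai_eig; under eq_bigr do rewrite expr1n;
  rewrite sumr_const card_ord.
Qed.

(** The closed form lambda(x) = 1 / (x + 1 + 1/x), freed of denominators: the
    geometric series gives (x^3 - 1) lambda(x) = x (x^(3k) - 1) = x (x - 1),
    and x - 1 cancels. *)
Lemma andrasfai_eigMx (F : fieldType) (k : nat) (x : F) :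
    (0 < k)%N -> x ^+ andrasfai_order k = 1 -> x != 1 ->
  andrasfai_eig k x * (1 + x + x ^+ 2) = x.
Proof.
move=> k_gt0 xn1 x_neq1.
have x3k : (x ^+ 3) ^+ k = x.
  rewrite -exprM (_ : (3 * k)%N = (andrasfai_order k).+1); last first.
    by rewrite /andrasfai_order; lia.
  by rewrite exprS xn1 mulr1.
have eigE : andrasfai_eig k x = x * \sum_(i < k) (x ^+ 3) ^+ i.
  rewrite mulr_sumr; apply: eq_bigr => i _.
  by rewrite addn1 exprS exprM.
apply: (mulfI (_ : x - 1 != 0)); first by rewrite subr_eq0.
have geom := subrX1 (x ^+ 3) k; rewrite x3k in geom.
rewrite [RHS]mulrC [in RHS]geom eigE; ring.
Qed.

Lemma andrasfai_eig_inv (F : fieldType) (k : nat) (x y : F) :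
    (0 < k)%N -> x ^+ andrasfai_order k = 1 -> x * y = 1 ->
  andrasfai_eig k x = andrasfai_eig k y.
Proof.
move=> k_gt0 xn1 xy1.
have yn1 : y ^+ andrasfai_order k = 1.
  by rewrite -[LHS]mul1r -{1}xn1 -exprMn xy1 expr1n.
have [x1 | x_neq1] := eqVneq x 1; first by rewrite x1 -xy1 x1 mul1r.
have y_neq1 : y != 1 by apply: contraNneq x_neq1 => y1; rewrite -xy1 y1 mulr1.
have x_eq := andrasfai_eigMx k_gt0 xn1 x_neq1.
have y_eq := andrasfai_eigMx k_gt0 yn1 y_neq1.
have x_neq0 : x != 0.
  by apply: contra_eq_neq xy1 => ->; rewrite mul0r eq_sym oner_eq0.
have d_neq0 : 1 + x + x ^+ 2 != 0.
  by apply: contraNneq x_neq0 => d0; rewrite -x_eq d0 mulr0.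
apply: (mulIf d_neq0); rewrite x_eq.
have -> : 1 + x + x ^+ 2 = x ^+ 2 * (1 + y + y ^+ 2).
  transitivity ((x * y) ^+ 2 + x * (x * y) + x ^+ 2); last by ring.
  by rewrite xy1 expr1n mulr1.
by rewrite mulrCA y_eq expr2 -mulrA xy1 mulr1.
Qed.

(** Equality case of the triangle inequality: k numbers of modulus 1 sum to k
    only if all of them are 1, in particular the first one, which is x. *)
Lemma andrasfai_eig_max (C : numClosedFieldType) (k n : nat) (x : C) :
    (0 < k)%N -> (0 < n)%N -> x ^+ n = 1 ->
  andrasfai_eig k x = k%:R -> x = 1.
Proof.
move=> k_gt0 n_gt0 xn1 eig_k.
have normx : `|x| = 1.
  by apply/eqP; rewrite -(@pexpr_eq1 _ _ n) // -normrX xn1 normr1.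
have all1 : forall i : 'I_k, true -> x ^+ (3 * i + 1) = 1.
  apply: (normC_sum_upper (P := xpredT) (G := fun=> 1)) => [i _|].
    by rewrite normrX normx expr1n.
  by rewrite sumr_const card_ord.
exact: all1 (Ordinal k_gt0) isT.
Qed.

Lemma andrasfai_eig_eqE (C : numClosedFieldType) (k : nat) (x y : C) :
    (0 < k)%N -> x ^+ andrasfai_order k = 1 -> y ^+ andrasfai_order k = 1 ->
  (andrasfai_eig k x == andrasfai_eig k y) = (x == y) || (x * y == 1).
Proof.
move=> k_gt0 xn1 yn1.
have n_gt0 : (0 < andrasfai_order k)%N by apply/ltnW/andrasfai_order_gt1.
apply/idP/idP => [/eqP eig_xy | /orP[/eqP-> // | /eqP xy1]]; last first.
  by rewrite (andrasfai_eig_inv k_gt0 xn1 xy1).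
have [x1 | x_neq1] := eqVneq x 1.
  rewrite x1 andrasfai_eig1 in eig_xy.
  by rewrite x1 (andrasfai_eig_max k_gt0 n_gt0 yn1) ?eqxx.
have [y1 | y_neq1] := eqVneq y 1.
  rewrite y1 andrasfai_eig1 in eig_xy.
  by rewrite y1 (andrasfai_eig_max k_gt0 n_gt0 xn1) ?eqxx.
have x_eq := andrasfai_eigMx k_gt0 xn1 x_neq1.
have y_eq := andrasfai_eigMx k_gt0 yn1 y_neq1.
rewrite -eig_xy in y_eq; set L := andrasfai_eig k x in x_eq y_eq.
have L_neq0 : L != 0.
  apply: contraTneq n_gt0 => L0; move: xn1; rewrite -x_eq L0 mul0r expr0n.
  by case: eqP => [-> //|_ /eqP]; rewrite eq_sym oner_eq0.
have /eqP : L * ((x - y) * (x * y - 1)) = 0.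
  (* Cross-multiply x / (1 + x + x^2) = y / (1 + y + y^2). *)
  transitivity (L * (1 + x + x ^+ 2) * y - L * (1 + y + y ^+ 2) * x).
    by ring.
  by rewrite x_eq y_eq; ring.
by rewrite !mulf_eq0 (negPf L_neq0) !subr_eq0.
Qed.

Theorem theorem3p1 (C : numClosedFieldType) (k : nat) (k_ge1 : (1 <= k)%N) :
  has_n_distinct_eigenvalues (adjacency_mx C (@andrasfai k)) (k + uphalf k).
Proof.
set n := andrasfai_order k.
have n_gt1 : (1 < n)%N by apply: andrasfai_order_gt1.
have n_def : (Zp_trunc n).+2 = n by rewrite Zp_cast.
have [w prim_w] : exists w : C, n.-primitive_root w.
  by apply: closed_prim_root_exists; rewrite pnatr_eq0 -lt0n ltnW.
have wX1 j : (w ^+ j) ^+ n = 1.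
  by rewrite exprAC (prim_expr_order prim_w) expr1n.
exists [seq andrasfai_eig k (w ^+ j) | j <- iota 0 (n./2).+1]; split.
- rewrite map_inj_in_uniq ?iota_uniq // => i j.
  rewrite !mem_iota !add0n !ltnS => /andP[_ i_le] /andP[_ j_le] /eqP.
  rewrite andrasfai_eig_eqE // -exprD -(expr0 w).
  rewrite !(eq_prim_root_expr prim_w) mod0n => /orP[/eqP | ].
    by rewrite !modn_small //; lia.
  (* Here 0 <= i + j <= n, so either i = j = 0 or i = j = n / 2. *)
  by move=> /dvdnP[[|[|q]]]; rewrite ?mulSn; lia.
- have prim_w' : (Zp_trunc n).+2.-primitive_root w by rewrite n_def.
  move=> a; apply/mapP/(eigenvalue_cayley_ZnP _ _ prim_w') => [[j] | [j ->]].
  + rewrite mem_iota add0n ltnS => /andP[_ j_le] ->.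
    have j_lt : (j < (Zp_trunc n).+2)%N by rewrite n_def; lia.
    by exists (Ordinal j_lt); rewrite -sum_andrasfai_set.
  + rewrite sum_andrasfai_set //.
    have j_lt : (j < n)%N by rewrite -[X in (_ < X)%N]n_def.
    have [j_le | j_gt] := leqP j n./2.
      by exists (nat_of_ord j); rewrite // mem_iota.
    exists (n - j)%N; first by rewrite mem_iota; lia.
    apply: andrasfai_eig_inv => //.
    by rewrite -exprD subnKC ?(prim_expr_order prim_w) // ltnW.
- by rewrite size_map size_iota /n /andrasfai_order; lia.
Qed.
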